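(* Let $(S,\mathcal S)$ be a measurable space with $\mathcal S$ countably generated, $\lambda$ a probability measure on $(S,\mathcal S)$, and $\mathcal G$ a sub-$\sigma$-algebra of $\mathcal S$. Suppose that $(S,\mathcal S,\lambda)$ has a $\mathcal G$-atom $D$ with $\lambda(D)>0$. Then there exists a measurable correspondence $G$ from $(S,\mathcal S,\lambda)$ to $\{0,1\}$ (i.e. $G(s)$ is a nonempty subset of $\{0,1\}$ for each $s$) such that $\mathcal I^{(\mathcal S,\mathcal G,\lambda)}_G\neq\mathcal I^{(\mathcal S,\mathcal G,\lambda)}_{\mathrm{co}(G)}$.
   Context: **$\mathcal G$-atoms.** For $D\in\mathcal S$ let $\mathcal G^D=\{D\cap D':D'\in\mathcal G\}$, $\mathcal S^D=\{D\cap D':D'\in\mathcal S\}$. A set $D\in\mathcal S$ of positive measure is a $\mathcal G$-atom (under $\lambda$) if $\{E\triangle E_0: E\in\mathcal G^D,\ E_0\in\mathcal S^D,\ \lambda(E_0)=0\}=\mathcal S^D$. **Conditional expectations of correspondences.** A correspondence $G$ from $S$ to $\mathbb R^n$ is $\mathcal S$-measurable if $\{s:G(s)\cap B\ne\emptyset\}\in\mathcal S$ for every closed $B$. $\mathrm{co}(G)$ is the correspondence $s\mapsto\mathrm{co}(G(s))$ (convex hull). For an integrably bounded correspondence $G$ (i.e. there is an integrable $\varphi:S\to\mathbb R_+$ such that, for $\lambda$-almost all $s$, every element of $G(s)$ has norm at most $\varphi(s)$), $$\mathcal I^{(\mathcal S,\mathcal G,\lambda)}_G=\{\mathbb E^\lambda(g|\mathcal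 G): g\text{ is an }\mathcal S\text{-measurable selection of }G\},$$ where the conditional expectation is taken with respect to $\lambda$ and functions are identified when equal $\lambda$-almost surely. *)

(* Defs.v *)
From HB Require Import structures.
From mathcomp Require Import all_boot all_order all_algebra.
From mathcomp Require Import all_classical all_reals all_analysis.

Set Implicit Arguments.
Unset Strict Implicit.
Unset Printing Implicit Defensive.

Import Order.TTheory GRing.Theory Num.Theory.
Import numFieldNormedType.Exports.

Local Open Scope classical_set_scope.
Local Open Scope ring_scope.

Definition countably_generated d (T : measurableType d) : Prop :=
  exists C : set (set T), countable C /\ @measurable d T = <<s C >>.

Definition sub_sigma_algebra_of d (T : measurableType d)
    (G : set (set T)) : Prop :=
  sigma_algebra setT G /\ G `<=` @measurable d T.

Definition trace_on {T : Type} (H : set (set T)) (D : set T) : set (set T) :=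
  [set D `&` D' | D' in H].

(* [`+`] is the symmetric difference of sets. *)
Definition is_atom_over d (T : measurableType d) (R : realType)
    (lambda : probability T R) (G : set (set T)) (D : set T) : Prop :=
  [/\ measurable D, (0 < lambda D)%E &
    [set E `+` E0 | E in trace_on G D
                  & E0 in [set E0 | trace_on measurable D E0 /\
                                    lambda E0 = 0%E]]
    = trace_on measurable D].

(* Correspondences are stated with values in the real line, that is R^n with
   n = 1, which is where a {0,1}-valued correspondence and its convex hull
   live; nonemptiness of the values is a separate hypothesis. *)
Definition measurable_correspondence d (T : measurableType d) (R : realType)
    (F : T -> set R) : Prop :=
  forall B : set R, closed B -> measurable [set s | (F s `&` B) !=set0].

Definition convex_hull (K : numDomainType) (M : lmodType K) (A : set M) :
    set M :=
  smallest (@convex_set K M) A.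

Definition co (T : Type) (R : realType) (F : T -> set R) : T -> set R :=
  fun s => convex_hull (F s : set R^o).

Definition measurable_selection d (T : measurableType d) (R : realType)
    (F : T -> set R) (g : T -> R) : Prop :=
  measurable_fun setT g /\ forall s, F s (g s).

(* E(g | G) as a class of functions modulo almost sure equality: the set of
   all its versions. For a sub-sigma-algebra G and an integrable g it is
   nonempty, and two such sets are equal as soon as they share a version. *)
Definition cond_exp d (T : measurableType d) (R : realType)
    (lambda : probability T R) (G : set (set T)) (g : T -> R) :
    set (T -> R) :=
  [set h : T -> R |
    [/\ @measurable_fun _ _ (g_sigma_algebraType G) R setT h,
        lambda.-integrable setT (EFin \o h) &
        forall A, G A ->
          (\int[lambda]_(s in A) (h s)%:E = \int[lambda]_(s in A) (g s)%:E)%E]].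

(* Since conditional expectations are classes of functions, this is a set of
   such classes. It is meant for integrably bounded F, whose measurable
   selections are all integrable. *)
Definition cond_exps d (T : measurableType d) (R : realType)
    (lambda : probability T R) (G : set (set T)) (F : T -> set R) :
    set (set (T -> R)) :=
  [set cond_exp lambda G g | g in measurable_selection F].

(* Main.v *)
(* On a G-atom D, let F be {0,1} on D and {0} elsewhere, and let the selection
   of co F be half the indicator of D. If it had the same conditional
   expectation as a selection of F, i.e. as the indicator of some A included in
   D, then lambda (A `&` C) = lambda (D `&` C) / 2 for all C in G. But A agrees
   up to a null set with D `&` D' for some D' in G: C = D' forces A to be null,
   and then C = setT forces D to be null. *)
Require Import Defs.
From HB Require Import structures.
From mathcomp Require Import all_boot all_order all_algebra.
From mathcomp Require Import all_classical all_reals all_analysis.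
From mathcomp Require Import measurable_realfun lra.

Import Order.TTheory GRing.Theory Num.Theory.
Import numFieldNormedType.Exports.

Local Open Scope classical_set_scope.
Local Open Scope ring_scope.

(* Since [cond_exp] is a set of versions, this existence result is what allows
   two integrands with equal [cond_exp] to be compared. *)
Lemma cond_exp_nonempty (R : realType) (d : measure_display)
    (S : measurableType d) (lambda : probability S R) (G : set (set S))
    (g : S -> R) :
  sub_sigma_algebra_of G -> lambda.-integrable setT (EFin \o g) ->
  cond_exp lambda G g !=set0.
Proof.
move=> [sG Gm] ig.
have GE : @measurable _ (g_sigma_algebraType G) = G.
  exact: measurable_g_measurableTypeE.
(* The identity, read as a map from [S] to [S] equipped with [G]: pushing forward along it restricts
   measures and charges to [G]. *)
pose p : S -> g_sigma_algebraType G := id.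
have mp : measurable_fun setT p.
  by move=> _ A mA; rewrite setTI; apply: Gm; rewrite -GE.
pose pm : {mfun S >-> g_sigma_algebraType G} :=
  HB.pack p (isMeasurableFun.Build _ _ _ _ _ mp).
pose mu : probability (g_sigma_algebraType G) R := distribution lambda pm.
pose nu0 : {charge set S -> \bar R} := induced_charge ig.
pose nu : {charge set (g_sigma_algebraType G) -> \bar R} :=
  measure_function_pushforward__canonical__charge_Charge nu0 mp.
have mg : measurable_fun setT (EFin \o g) by exact: measurable_int ig.
have numu : nu `<< mu.
  apply: (dominates_pushforward mp); apply/null_content_dominatesP => A mA A0.
  apply: (@null_set_integral _ _ _ _ _ (EFin \o g)) => //.
  exact: measurable_funTS.
(* Density of the restricted charge with respect to the restricted probability: it is [G]-measurable
   by construction, and finite everywhere, so [fine] alters no value. *)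
pose f := Radon_Nikodym nu mu.
have if_ : mu.-integrable setT f by exact: Radon_Nikodym_integrable.
have mf : measurable_fun setT f by exact: measurable_int if_.
have fE s : (fine (f s))%:E = f s by rewrite fineK// Radon_Nikodym_fin_num.
have ifl : lambda.-integrable setT (f : S -> \bar R).
  apply/integrableP; split.
    exact: (measurableT_comp mf mp).
  have /integrableP[_] := if_.
  by rewrite ge0_integral_distribution//; exact: measurableT_comp.
have fineE : EFin \o (fine \o f) = f by apply/funext => s /=; rewrite fE.
exists (fine \o f); split.
- exact: measurableT_comp.
- by rewrite fineE.
move=> A GA; transitivity (nu A) => //.
have mA : @measurable _ (g_sigma_algebraType G) A by rewrite GE.
rewrite (Radon_Nikodym_integral numu mA) integral_pushforward//.
  by apply: eq_integral => s _ /=; rewrite fE.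
apply: integrableS ifl => //; exact: Gm.
Qed.

Lemma convex_hull_conv (K : numDomainType) (M : lmodType K) (A : set M)
    (x y : M) (t : {i01 K}) :
  A x -> A y -> convex_hull A (t%:num *: x + (1 - t%:num) *: y).
Proof.
move=> Ax Ay B [cB AB].
by have := cB x y t; rewrite !inE; apply; exact: AB.
Qed.

Theorem proposition4 (R : realType) (d : measure_display)
    (S : measurableType d) (lambda : probability S R) (G : set (set S))
    (S_cg : countably_generated S)
    (G_sub : sub_sigma_algebra_of G)
    (G_atom : exists D : set S, is_atom_over lambda G D /\ (0 < lambda D)%E) :
  exists F : S -> set R,
    [/\ forall s, F s !=set0,
        forall s, F s `<=` [set 0; 1],
        measurable_correspondence F &
        cond_exps lambda G F <> cond_exps lambda G (co F)].
Proof.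
case: G_atom => D [[mD _ atomD] D_gt0].
have [sG Gm] := G_sub.
pose F (s : S) := [set x : R | x = 0 \/ x = 1 /\ D s].
exists F; split.
- by move=> s; exists 0; left.
- by move=> s x [->|[-> _]]; [left|right].
(* Since 0 lies in every [F s], the set to be measured is [setT], [D] or [set0], according to which
   of 0 and 1 belong to [B]. *)
- move=> B _; have [B0|nB0] := pselect (B 0).
    rewrite [X in measurable X](_ : _ = setT)//; apply/seteqP; split=> // s _.
    by exists 0; split => //; left.
  have [B1|nB1] := pselect (B 1).
    rewrite [X in measurable X](_ : _ = D)//; apply/seteqP; split => [s|s Ds].
      by move=> [x [[->//|[_ Ds]]]].
    by exists 1; split => //; right.
  rewrite [X in measurable X](_ : _ = set0)//; apply/seteqP; split => // s.
  by move=> [x [[->|[-> _]]]].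
move=> FcoF.
pose g (s : S) : R := 2^-1 * \1_D s.
have selg : measurable_selection (co F) g.
  split; first exact: measurable_funM.
  move=> s; rewrite /g indicE; have [Ds|nDs] := pselect (D s).
    have half_ge0 : 0 <= 2^-1 :> R by lra.
    have half_le1 : 2^-1 <= 1 :> R by lra.
    have : co F s (2^-1 *: (1 : R^o) + (1 - 2^-1) *: (0 : R^o)).
      by apply: (@convex_hull_conv _ _ _ _ _ (Itv01 half_ge0 half_le1));
        [right|left].
    by rewrite scaler0 addr0 mem_set.
  rewrite memNset// mulr0 => B [_]; apply.
  by left.
have ig : lambda.-integrable setT (EFin \o g).
  rewrite [X in integrable _ _ X](_ : _ =
    fun s => ((2^-1)%:E * (\1_D s)%:E)%E)//.
  apply: integrableZl => //; exact: integrable_indic.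
(* A single version [h], shared below by [g] and [f], links their integrals over sets of [G]. *)
have [h hg] := cond_exp_nonempty R d S lambda G g G_sub ig.
have : cond_exps lambda G (co F) (cond_exp lambda G g) by exists g.
rewrite -FcoF => -[f [mf Ff] fg].
have hf : cond_exp lambda G f h by rewrite fg.
pose A := f @^-1` [set 1].
have mA : measurable A by rewrite -[A]setTI; exact: mf.
have fE s : f s = \1_A s.
  rewrite indicE; case: (Ff s) => [fs0|[fs1 _]].
    by rewrite memNset// /A/= fs0; apply/eqP; rewrite eq_sym oner_eq0.
  by rewrite mem_set// fs1.
have AD : A `<=` D.
  move=> s As; case: (Ff s) => [fs0|[]//].
  by have := As; rewrite /A/= fs0 => /eqP; rewrite eq_sym oner_eq0.
have half C : G C -> lambda (A `&` C) = ((2^-1)%:E * lambda (D `&` C))%E.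
  move=> GC; have mC := Gm _ GC.
  have [_ _ /(_ _ GC) Hf] := hf; have [_ _ /(_ _ GC) Hg] := hg.
  rewrite -integral_indic// -integral_indic//.
  rewrite -integralZl//; last first.
    by apply: (integrableS measurableT) => //; exact: integrable_indic.
  by under eq_integral do rewrite -fE; rewrite -Hf Hg.
(* [A] is a measurable part of [D], so the atom property writes it as the symmetric difference of
   [D]&[D'] and a null set [E0]. *)
have [E [D' GD' DE] [E0 [[E0' mE0' DE0] E0_0] AE]] :
    [set E `+` E0 | E in trace_on G D
      & E0 in [set E0 | trace_on measurable D E0 /\ lambda E0 = 0%E]] A.
  by rewrite atomD; exists A => //; exact/setIidPr.
have mD' := Gm _ GD'.
have mE0 : measurable E0 by rewrite -DE0; exact: measurableI.
(* Outside [E0], points of [D]&[D'] lie in [A]. With [half] at [D'], the finite number x =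
   [lambda (D]&[D')] satisfies x <= x / 2. *)
have DD'_null : lambda (D `&` D') = 0%E.
  have : (lambda (D `&` D') <= lambda (A `&` D') + lambda E0)%E.
    have mAD' : measurable (A `&` D') by exact: measurableI.
    apply: le_trans (measureU2 lambda mAD' mE0).
    apply: le_measure; rewrite ?inE; [exact: measurableI|exact: measurableU|].
    move=> s [Ds D's]; have [E0s|nE0s] := pselect (E0 s); first by right.
    by left; split => //; rewrite -AE; left; split => //; rewrite -DE.
  rewrite E0_0 adde0 half//.
  have : (0 <= lambda (D `&` D'))%E by [].
  rewrite -(@fineK _ (lambda (D `&` D'))) ?fin_num_measure//; last first.
    exact: measurableI.
  rewrite -EFinM !lee_fin => ? ?; congr EFin; lra.
have A_null : lambda A = 0%E.
  have mDD' : measurable (D `&` D') by exact: measurableI.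
  have : (lambda A <= lambda (D `&` D') + lambda E0)%E.
    apply: le_trans (measureU2 lambda mDD' mE0).
    apply: le_measure; rewrite ?inE//; first exact: measurableU.
    by rewrite -AE -DE => s [[]|[]]; [left|right].
  by rewrite DD'_null E0_0 adde0 measure_le0 => /eqP.
(* Taking [setT] in [half] gives 0 = [lambda D] / 2, against [D_gt0]. *)
have GT : G setT by case: sG => G0 GC _; rewrite -[setT]setD0; exact: GC.
have := half _ GT; rewrite !setIT A_null => /esym/eqP.
by rewrite mule_eq0 eqe invr_eq0 pnatr_eq0/= gt_eqF.
Qed.
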